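(* Let $A,B\in\mathbb{R}^{m\times n}$, let $T=[\,A+B\;\;\;-A+B\,]\in\mathbb{R}^{m\times 2n}$, and suppose that $$\operatorname{Ker}(T)^{\perp}\cap \hat C_2=\{0\},\qquad \hat C_2:=\{w=(u,v)\in\mathbb{R}^n\times\mathbb{R}^n: u_iv_i=0\ \ \forall i=1,\dots,n\}.$$ Let $\Omega:=\{w=(u,v)\in\mathbb{R}^n\times\mathbb{R}^n:(u_i,v_i)\notin\mathbb{R}^2_{--}\ \ \forall i=1,\dots,n\}$. Then for any $c\in\mathbb{R}^m$, $$\operatorname{Fix}(P_{C_1}\circ P_{C_2})\cap\Omega=C_1\cap C_2 .$$
   Context: $\mathbb{R}^2_{--}=\{(a,b)\in\mathbb{R}^2:a<0,\ b<0\}$. For $c\in\mathbb{R}^m$, $C_1:=\{w\in\mathbb{R}^n\times\mathbb{R}^n: Tw=\sqrt2\,c\}$ and $C_2:=\{w=(u,v)\in\mathbb{R}^n\times\mathbb{R}^n: u\ge 0,\ v\ge 0,\ \langle u,v\rangle=0\}$ (inequalities componentwise). For a set $S$, $P_S(z):=\{s\in S:\|s-z\|\le\|t-z\|\ \forall t\in S\}$ is the (possibly multivalued, possibly empty if $S=\emptyset$) Euclidean metric projector. $(P_{C_1}\circ P_{C_2})(w)=\bigcup_{w'\in P_{C_2}(w)}P_{C_1}(w')$, and $\operatorname{Fix}(P_{C_1}\circ P_{C_2})=\{w: w\in(P_{C_1}\circ P_{C_2})(w)\}$. *)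

(* Defs.v *)
From mathcomp Require Import all_boot all_order all_algebra.
From mathcomp Require Import classical_sets reals.

Set Implicit Arguments.
Unset Strict Implicit.
Unset Printing Implicit Defensive.

Import Order.TTheory GRing.Theory Num.Theory.

Local Open Scope classical_set_scope.
Local Open Scope ring_scope.

(* A pair w = (u, v) in R^n x R^n is the column vector w : 'cV[R]_(n + n)
   with u = usubmx w and v = dsubmx w. *)

Definition dotp (R : realType) (k : nat) (x y : 'cV[R]_k) : R :=
  \sum_(i < k) x i 0 * y i 0.

(* The norm `|x| that MathComp-Analysis puts on matrices is the max norm,
   hence a separate definition of the Euclidean norm. *)
Definition enorm (R : realType) (k : nat) (x : 'cV[R]_k) : R :=
  Num.sqrt (dotp x x).

Definition metric_proj (R : realType) (k : nat) (S : set 'cV[R]_k) (z : 'cV[R]_k) :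
    set 'cV[R]_k :=
  [set s | S s /\ forall t, S t -> enorm (s - z) <= enorm (t - z)].

Definition multicomp (X Y Z : Type) (F : Y -> set Z) (G : X -> set Y) (x : X) :
    set Z :=
  \bigcup_(y in G x) F y.

Definition fixpts (X : Type) (F : X -> set X) : set X := [set x | F x x].

Definition Ker (R : realType) (m k : nat) (T : 'M[R]_(m, k)) : set 'cV[R]_k :=
  [set x | T *m x = 0].

Definition orthoc (R : realType) (k : nat) (S : set 'cV[R]_k) :
    set 'cV[R]_k :=
  [set x | forall y, S y -> dotp x y = 0].

Definition Tmx (R : realType) (m n : nat) (A B : 'M[R]_(m, n)) :
    'M[R]_(m, n + n) :=
  row_mx (A + B) (- A + B).

Definition C1 (R : realType) (m n : nat) (A B : 'M[R]_(m, n)) (c : 'cV[R]_m) :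
    set 'cV[R]_(n + n) :=
  [set w | Tmx A B *m w = Num.sqrt 2 *: c].

Definition C2 (R : realType) (n : nat) : set 'cV[R]_(n + n) :=
  [set w | [/\ forall i, 0 <= usubmx w i 0,
               forall i, 0 <= dsubmx w i 0 &
               dotp (usubmx w) (dsubmx w) = 0]].

Definition C2hat (R : realType) (n : nat) : set 'cV[R]_(n + n) :=
  [set w | forall i, usubmx w i 0 * dsubmx w i 0 = 0].

Definition negquadrant (R : realType) : set (R * R) :=
  [set p | p.1 < 0 /\ p.2 < 0].

Definition Omega (R : realType) (n : nat) : set 'cV[R]_(n + n) :=
  [set w | forall i, ~ negquadrant (usubmx w i 0, dsubmx w i 0)].

Arguments C2 {R n}.
Arguments C2hat {R n}.
Arguments Omega {R n}.

(* Main.v *)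
Require Import Defs.
From mathcomp Require Import all_boot all_order all_algebra.
From mathcomp Require Import classical_sets reals.
From mathcomp Require Import ring lra.

Import Order.TTheory GRing.Theory Num.Theory.
Local Open Scope classical_set_scope.
Local Open Scope ring_scope.

(** Write a fixed point as w in P_C1(w') with w' in P_C2(w).  Since C1 is a
    translate of Ker T, the displacement w - w' is orthogonal to Ker T
    ([affine_proj_orth]).  On the other hand C2 is a product over i of the
    planar crosses {a, b >= 0, a b = 0}, so w' is optimal in each plane
    separately ([proj_C2_coord]); and a planar point outside the open negative
    quadrant is projected onto the cross by changing at most one of its
    coordinates ([planar_cross_proj]).  Hence w - w' also lies in C2hat, the
    transversality hypothesis forces w = w', and this common point belongs to
    both C1 and C2.  Conversely a point of a set is its own projection, and
    the nonnegative coordinates of a point of C2 keep it in Omega. *)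

Section EuclideanProjection.

Context {R : realType}.
Implicit Types k m n : nat.

Lemma dotpp_ge0 k (x : 'cV[R]_k) : 0 <= dotp x x.
Proof. by apply: sumr_ge0 => i _; rewrite -expr2 sqr_ge0. Qed.

Lemma ler_enorm k (x y : 'cV[R]_k) :
  (enorm x <= enorm y) = (dotp x x <= dotp y y).
Proof. by rewrite /enorm ler_sqrt ?dotpp_ge0. Qed.

Lemma metric_proj_self k (S : set 'cV[R]_k) z : S z -> metric_proj S z z.
Proof.
move=> Sz; split=> // t _; rewrite ler_enorm subrr /dotp.
by rewrite big1 ?dotpp_ge0 // => i _; rewrite mxE mul0r.
Qed.

Lemma dotp_addZ k (t : R) (x y : 'cV[R]_k) :
  dotp (x + t *: y) (x + t *: y) =
  dotp x x + 2 * t * dotp x y + t ^+ 2 * dotp y y.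
Proof.
rewrite /dotp !mulr_sumr -!big_split /=; apply: eq_bigr => i _.
rewrite !mxE; ring.
Qed.

(** First-order optimality: moving s along a kernel direction y stays in the
    affine space, so t |-> 2 t <s - z, y> + t^2 |y|^2 is nonnegative, which
    forces its linear coefficient to vanish. *)
Lemma affine_proj_orth m k (T : 'M[R]_(m, k)) (b : 'cV[R]_m) (z s : 'cV[R]_k) :
  metric_proj [set x | T *m x = b] z s -> orthoc (Ker T) (s - z).
Proof.
case=> /= Ts smin y /= Ty.
set d := dotp (s - z) y; set e := dotp y y.
have e0 : 0 <= e by exact: dotpp_ge0.
have e1 : 1 + e != 0 by rewrite gt_eqF // ltr_wpDr.
(* The exact minimizer of the quadratic is - d / e; dividing by 1 + e instead
   still decreases it unless d = 0, and also covers y = 0. *)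
pose t := - d / (1 + e).
have : dotp (s - z) (s - z) <= dotp (s + t *: y - z) (s + t *: y - z).
  by rewrite -ler_enorm; apply: smin; rewrite /= mulmxDr -scalemxAr Ty scaler0 addr0.
rewrite addrAC dotp_addZ -/d -/e -addrA lerDl => ht.
have td : t * (1 + e) = - d by rewrite /t divfK.
have : t ^+ 2 * (2 + e) <= 0 by nra.
rewrite pmulr_lle0 ?ltr_wpDr // => t2.
have t0 : t = 0 by apply/eqP; rewrite -sqrf_eq0 eq_le t2 sqr_ge0.
by move: td; rewrite t0 mul0r; lra.
Qed.

Lemma dotpp_subE n (x y : 'cV[R]_(n + n)) :
  dotp (x - y) (x - y) =
  \sum_(i < n) ((usubmx x i 0 - usubmx y i 0) ^+ 2 +
                (dsubmx x i 0 - dsubmx y i 0) ^+ 2).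
Proof.
rewrite /dotp big_split_ord big_split /=.
by congr (_ + _); apply: eq_bigr => i _; rewrite !mxE expr2.
Qed.

Lemma C2_coord n (w : 'cV[R]_(n + n)) :
  C2 w <-> forall i, [/\ 0 <= usubmx w i 0, 0 <= dsubmx w i 0 &
                         usubmx w i 0 * dsubmx w i 0 = 0].
Proof.
split=> [[u0 v0 uv] i|h].
  split=> //; apply: (psumr_eq0P _ uv) => // j _; exact: mulr_ge0.
split=> [i|i|]; [by case: (h i) | by case: (h i) |].
by apply: big1 => i _; case: (h i).
Qed.

(** C2 is a product of planar crosses and the squared distance is a sum over
    the planes, so overwriting one pair of coordinates of a minimizer with a
    competitor (p, q) can only increase the contribution of that plane. *)
Lemma proj_C2_coord n (w s : 'cV[R]_(n + n)) (i : 'I_n) (p q : R) :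
  metric_proj C2 w s -> 0 <= p -> 0 <= q -> p * q = 0 ->
  (usubmx s i 0 - usubmx w i 0) ^+ 2 + (dsubmx s i 0 - dsubmx w i 0) ^+ 2 <=
  (p - usubmx w i 0) ^+ 2 + (q - dsubmx w i 0) ^+ 2.
Proof.
case=> /C2_coord sC2 smin p0 q0 pq.
pose u' : 'cV[R]_n := \col_j (if j == i then p else usubmx s j 0).
pose v' : 'cV[R]_n := \col_j (if j == i then q else dsubmx s j 0).
have u'E j : u' j 0 = if j == i then p else usubmx s j 0 by rewrite mxE.
have v'E j : v' j 0 = if j == i then q else dsubmx s j 0 by rewrite mxE.
have /smin : C2 (col_mx u' v').
  apply/C2_coord => j; rewrite col_mxKu col_mxKd u'E v'E.
  by case: eqP => _; [split | exact: sC2].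
rewrite ler_enorm !dotpp_subE col_mxKu col_mxKd.
rewrite (bigD1 i) //= [leRHS](bigD1 i) //= u'E v'E eqxx.
rewrite [X in _ <= _ + X -> _](eq_bigr (fun j =>
  (usubmx s j 0 - usubmx w j 0) ^+ 2 + (dsubmx s j 0 - dsubmx w j 0) ^+ 2)).
  by rewrite lerD2r.
by move=> j /negPf ji; rewrite u'E v'E ji.
Qed.

(** If (a, b) sits on the horizontal half-axis, comparing it with (u, 0) when
    u >= 0 gives a = u; when u < 0, being outside the negative quadrant means
    v >= 0, and comparing with (0, v) gives b = v.  The
    vertical case is symmetric. *)
Lemma planar_cross_proj (u v a b : R) :
  ~ negquadrant (u, v) -> 0 <= a -> 0 <= b -> a * b = 0 ->
  (forall p q, 0 <= p -> 0 <= q -> p * q = 0 ->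
    (a - u) ^+ 2 + (b - v) ^+ 2 <= (p - u) ^+ 2 + (q - v) ^+ 2) ->
  (a - u) * (b - v) = 0.
Proof.
wlog b0 : u v a b / b = 0.
  move=> H nq a0 b0 ab hmin; have /eqP := ab; rewrite mulf_eq0.
  case/orP=> /eqP E; last exact: H.
  rewrite mulrC; apply: H => //; first by case=> /= ? ?; apply: nq.
    by rewrite mulrC.
  move=> p q p0 q0 pq; rewrite addrC [leRHS]addrC; apply: hmin => //.
  by rewrite mulrC.
move=> nq a0 _ _ hmin; subst b.
have sqle0 (x : R) : x ^+ 2 <= 0 -> x = 0.
  by move=> x2; apply/eqP; rewrite -sqrf_eq0 eq_le x2 sqr_ge0.
case: (leP 0 u) => [u0|u0].
  have hu := hmin u 0 u0 (lexx 0) (mulr0 u).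
  by rewrite (sqle0 (a - u)) ?mul0r //; lra.
case: (leP 0 v) => [v0|v0]; last by case: nq.
have hv := hmin 0 v (lexx 0) v0 (mul0r v).
by rewrite (sqle0 (0 - v)) ?mulr0 //; nra.
Qed.

Lemma proj_C2_displacement n (w s : 'cV[R]_(n + n)) :
  Omega w -> metric_proj C2 w s -> C2hat (s - w).
Proof.
move=> wO ws i.
have -> : usubmx (s - w) i 0 = usubmx s i 0 - usubmx w i 0 by rewrite !mxE.
have -> : dsubmx (s - w) i 0 = dsubmx s i 0 - dsubmx w i 0 by rewrite !mxE.
have [/C2_coord/(_ i)[a0 b0 ab] _] := ws.
apply: planar_cross_proj (wO i) a0 b0 ab _ => p q p0 q0 pq.
exact: proj_C2_coord.
Qed.

End EuclideanProjection.

Theorem theorem2p6 (R : realType) (m n : nat) (A B : 'M[R]_(m, n))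
    (hT : orthoc (Ker (Tmx A B)) `&` C2hat = [set 0])
    (c : 'cV[R]_m) :
  fixpts (multicomp (metric_proj (C1 A B c)) (metric_proj C2)) `&` Omega = C1 A B c `&` C2.
Proof.
apply/seteqP; split=> w.
  case=> -[s ws sw] wO.
  have orth : orthoc (Ker (Tmx A B)) (w - s).
    exact: affine_proj_orth sw.
  have cross : C2hat (w - s).
    move=> i; have := proj_C2_displacement _ _ _ wO ws i.
    by rewrite -(opprB s w) !linearN /= [(- usubmx _) i 0]mxE
               [(- dsubmx _) i 0]mxE mulrNN.
  have : [set 0] (w - s) by rewrite -hT; split.
  move=> /eqP; rewrite subr_eq0 => /eqP E.
  by split; [case: sw | rewrite E; case: ws].
case=> wC1 wC2; split.
  by exists w; apply: metric_proj_self.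
by move=> i []; case: wC2 => /(_ i) /= u0 _ _; rewrite ltNge u0.
Qed.
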